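(* Let $C\subset\mathbb{R}^n$ and let $F:\mathbb{R}^n\rightrightarrows\mathbb{R}^n$ be upper semicontinuous with $F(x)$ compact and convex for all $x\in\mathbb{R}^n$. Consider the constrained differential inclusion $\mathcal{H}_f=(C,F)$: $\dot x\in F(x)$, $x\in C$. Let $B:\mathbb{R}^n\to\mathbb{R}$ be lower semicontinuous. Then the following are equivalent: (i) for every solution $\phi$ to $\mathcal{H}_f$, the map $t\mapsto B(\phi(t))$ is nonincreasing on $\operatorname{dom}\phi$; (ii) the set $\operatorname{epi}B\cap(\operatorname{cl}(C)\times\mathbb{R})$ is forward pre-invariant for the augmented constrained differential inclusion $$\begin{bmatrix}\dot x\\ \dot r\end{bmatrix}\in\begin{bmatrix}F(x)\\0\end{bmatrix},\qquad (x,r)\in C\times\mathbb{R}.$$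
   Context: Solution to a constrained differential inclusion $(C,F)$ in $\mathbb{R}^n$ ($\dot x\in F(x)$, $x\in C$): a locally absolutely continuous function $\phi:\operatorname{dom}\phi\to\mathbb{R}^n$, with $\operatorname{dom}\phi\subset\mathbb{R}_{\ge0}$ an interval containing $0$ (possibly $\{0\}$), such that $\phi(0)\in\operatorname{cl}(C)$, $\phi(t)\in C$ for all $t\in\operatorname{int}(\operatorname{dom}\phi)$, and $\dot\phi(t)\in F(\phi(t))$ for almost all $t\in\operatorname{dom}\phi$. Solutions to the augmented inclusion are defined in the same way with data $(C\times\mathbb{R},\,(x,r)\mapsto F(x)\times\{0\})$ in $\mathbb{R}^{n+1}$. A set $K$ is forward pre-invariant for a constrained differential inclusion if each solution starting from $K$ remains in $K$ on its whole domain. $\operatorname{epi}B:=\{(x,r)\in\mathbb{R}^n\times\mathbb{R}: r\ge B(x)\}$; $\operatorname{cl}$ denotes closure. $F$ is upper semicontinuous if for every $x$ and every $\epsilon>0$ there is a neighborhood $U(x)$ of $x$ with $F(y)\subset F(x)+\epsilon\mathbb{B}$ for all $y\in U(x)$, $\mathbb{B}$ being the closed unit ball. *)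

(* Defs.v *)
From HB Require Import structures.
From mathcomp Require Import all_boot all_order all_algebra.
From mathcomp Require Import all_classical all_reals all_analysis.
Import Order.TTheory GRing.Theory Num.Theory.
Import numFieldNormedType.Exports.

Set Implicit Arguments.
Unset Strict Implicit.
Unset Printing Implicit Defensive.

Local Open Scope classical_set_scope.
Local Open Scope ring_scope.

(* The library norms on ['rV[R]_n] and on products are max norms. In finite
   dimension absolute continuity does not depend on the choice of norm. *)
Definition abs_continuous_on (R : realType) (V : normedModType R)
    (a b : R) (f : R -> V) : Prop :=
  forall e : R, 0 < e -> exists2 d : R, 0 < d &
    forall (m : nat) (s t : 'I_m -> R),
      (forall i, [/\ a <= s i, s i <= t i & t i <= b]) ->
      trivIset [set: 'I_m] (fun i => `]s i, t i[%classic) ->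
      \sum_(i < m) (t i - s i) < d ->
      \sum_(i < m) `|f (t i) - f (s i)| < e.

Definition loc_abs_continuous (R : realType) (V : normedModType R)
    (D : set R) (f : R -> V) : Prop :=
  forall a b : R, `[a, b]%classic `<=` D -> abs_continuous_on a b f.

(* A function [phi] with domain [D] is a total function of which only the
   restriction to [D] matters: the two-sided derivative sees values outside [D]
   only at the endpoints of the interval [D], which form a null set. *)
Definition is_solution (R : realType) (V : normedModType R)
    (C : set V) (F : V -> set V) (D : set R) (phi : R -> V) : Prop :=
  [/\ is_interval D, D 0 & D `<=` [set t | 0 <= t]] /\
  [/\ loc_abs_continuous D phi,
      closure C (phi 0),
      forall t, (D°)%classic t -> C (phi t) &
      {ae lebesgue_measure, forall t : R, D t ->
         derivable phi t 1 /\ F (phi t) (derive1 phi t)}].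

Definition forward_pre_invariant (R : realType) (V : normedModType R)
    (C : set V) (F : V -> set V) (K : set V) : Prop :=
  forall (D : set R) (phi : R -> V), is_solution C F D phi ->
    K (phi 0) -> forall t, D t -> K (phi t).

Definition unit_ball (R : realType) (n : nat) : set 'rV[R]_n :=
  [set v | Num.sqrt (\sum_(i < n) v 0 i ^+ 2) <= 1].

Definition upper_semicontinuous_map (R : realType) (n : nat)
    (F : 'rV[R]_n -> set 'rV[R]_n) : Prop :=
  forall (x : 'rV[R]_n) (e : R), 0 < e ->
    \forall y \near x,
      F y `<=` [set w + e *: u | w in F x & u in @unit_ball R n].

Definition epi (R : realType) (n : nat) (B : 'rV[R]_n -> R) :
    set ('rV[R]_n * R) :=
  [set z | B z.1 <= z.2].

Definition augmented_map (R : realType) (n : nat)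
    (F : 'rV[R]_n -> set 'rV[R]_n) (z : 'rV[R]_n * R) : set ('rV[R]_n * R) :=
  F z.1 `*` [set 0].

(* Main.v *)
(* (i) => (ii): the last component of an augmented solution is locally
   absolutely continuous with zero derivative almost everywhere, hence constant;
   so [B (phi t) <= B (phi 0) <= r 0 = r t]. (ii) => (i): if [phi] is a solution
   and [s] is in its domain, then [phi (t + s)] paired with the constant
   [B (phi s)] is an augmented solution starting in the epigraph.

   A function [f] that is absolutely continuous on a segment, with zero
   derivative off a null set [N], is constant by a gauge argument: given [e],
   cover [N] by an open set [U] of measure below the [d] of absolute continuity.
   A point of [U] has a neighbourhood inside [U]; near any other point the
   increments of [f] are at most [e] times the length. Cousin's lemma yields a
   subdivision into intervals of these two kinds, and the intervals in [U]
   contribute at most [e] in total. *)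
Require Import Defs.
From HB Require Import structures.
From mathcomp Require Import all_boot all_order all_algebra.
From mathcomp Require Import all_classical all_reals all_analysis.
From mathcomp Require Import measurable_realfun ring lra.
Import Order.TTheory GRing.Theory Num.Theory.
Import numFieldNormedType.Exports.
Local Open Scope classical_set_scope.
Local Open Scope ring_scope.

Set Implicit Arguments.
Unset Strict Implicit.

(** * Functions with zero derivative almost everywhere *)

Lemma cousin_segment (R : realType) (P : R -> R -> Prop) (a b : R) :
  a <= b ->
  (forall x y z, x <= y <= z -> P x y -> P y z -> P x z) ->
  (forall x, a <= x <= b -> exists2 d : R, 0 < d &
     forall y z, a <= y -> x - d < y <= x -> x <= z < x + d -> z <= b -> P y z) ->
  P a b.
Proof.
move=> ab Padd Ploc; pose S := [set x | a <= x <= b /\ P a x].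
have Sa : S a.
  split; first by rewrite lexx.
  have [|d d0] := Ploc a; first by rewrite lexx.
  by apply => //; lra.
have ubS : ubound S b by move=> x [/andP[]].
have supS : has_sup S by split; [exists a | exists b].
have ac : a <= sup S by apply: (sup_upper_bound supS).
have cb : sup S <= b by apply: ge_sup => //; exists a.
(* The gauge at [sup S] joins a point of [S] just below the supremum to the point [z] just above it,
   capped at [b]. Hence [z] lies in [S], and this is contradictory unless the cap is reached. *)
have [|d d0 Pd] := Ploc (sup S); first by rewrite ac cb.
have [y [/andP[ay yb] Py] yc] := sup_adherent d0 supS.
have yS : y <= sup S by apply: (sup_upper_bound supS); split => //; apply/andP.
pose z := Num.min b (sup S + d / 2).
have zb : z <= b by rewrite /z ge_min lexx.
have zd : z <= sup S + d / 2 by rewrite /z ge_min lexx orbT.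
have cz : sup S <= z by rewrite /z le_min cb/=; lra.
have Paz : P a z.
  apply: (Padd a y z) => //; first by apply/andP; split=> //; lra.
  by apply: Pd => //; lra.
have : z <= sup S.
  by apply: (sup_upper_bound supS); split=> //; apply/andP; split=> //; lra.
have [zE|zE] : z = b \/ z = sup S + d / 2.
  by rewrite /z; case: leP; [left|right].
  by rewrite zE in Paz.
by move=> zc; exfalso; lra.
Qed.

Lemma sum_itv_le_measure (R : realType) (U : set R) (m : nat) (s t : 'I_m -> R) :
  open U -> (forall i, s i <= t i) ->
  trivIset [set: 'I_m] (fun i => `]s i, t i[%classic) ->
  (forall i, `]s i, t i[ `<=` U) ->
  ((\sum_(i < m) (t i - s i))%:E <= lebesgue_measure U)%E.
Proof.
move=> oU st tI sub.
have -> : ((\sum_(i < m) (t i - s i))%:E =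
    \sum_(i < m) lebesgue_measure (`]s i, t i[%classic : set R))%E.
  rewrite -sumEFin; apply: eq_bigr => i _.
  rewrite lebesgue_measure_itv /= lte_fin; case: ltP => // ti.
  by rewrite (@le_anti _ _ (s i) (t i)) ?subrr// st.
rewrite -measure_semi_additive_ord //=.
- apply: le_measure; rewrite ?inE.
  + by apply: bigsetU_measurable.
  + exact: open_measurable.
  + by elim/big_ind: _ => [//|A B AU BU x [/AU|/BU]|i _]; last exact: sub.
- by apply: bigsetU_measurable.
Qed.

(** The relation to which Cousin's lemma is applied. The family is existential, so that the pieces
    in [U] can be gathered as a subdivision grows. It has the shape required by [abs_continuous_on],
    which is applied only once, to the final family. *)
Definition increment_covered (R : realType) (V : normedModType R)
    (f : R -> V) (e : R) (U : set R) (u v : R) : Prop :=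
  exists m (s t : 'I_m -> R),
    [/\ forall i, [/\ u <= s i, s i <= t i & t i <= v],
        trivIset [set: 'I_m] (fun i => `]s i, t i[%classic),
        forall i, `]s i, t i[ `<=` U &
        `|f v - f u| <= e * (v - u) + \sum_(i < m) `|f (t i) - f (s i)| ].

Lemma increment_covered_add (R : realType) (V : normedModType R)
    (f : R -> V) (e : R) (U : set R) (x y z : R) : x <= y <= z ->
  increment_covered f e U x y -> increment_covered f e U y z ->
  increment_covered f e U x z.
Proof.
move=> /andP[xy yz] [m [s [t [st tI sU fxy]]]] [m' [s' [t' [st' tI' sU' fyz]]]].
pose cat (g : 'I_m -> R) (g' : 'I_m' -> R) (i : 'I_(m + m')) :=
  match fintype.split i with inl j => g j | inr k => g' k end.
have catl g g' i : cat g g' (lshift m' i) = g i.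
  by rewrite /cat (unsplitK (inl _ i)).
have catr g g' i : cat g g' (rshift m i) = g' i.
  by rewrite /cat (unsplitK (inr _ i)).
exists (m + m')%N, (cat s s'), (cat t t'); split.
- move=> i; rewrite -(splitK i); case: (fintype.split i) => j /=.
    by rewrite !catl; have [? ? ?] := st j; split=> //; lra.
  by rewrite !catr; have [? ? ?] := st' j; split=> //; lra.
- move=> i j _ _ [r]; rewrite -(splitK i) -(splitK j).
  case: (fintype.split i) (fintype.split j) => k [l|l] /=; rewrite ?catl ?catr.
  + by move=> h; rewrite (tI k l)//; exists r.
  (* Intervals from different families are separated by [y], so they cannot share a point. *)
  + have [_ _ ?] := st k; have [? _ _] := st' l.
    by rewrite !in_itv /= => -[/andP[? ?] /andP[? ?]]; exfalso; lra.
  + have [? _ _] := st' k; have [_ _ ?] := st l.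
    by rewrite !in_itv /= => -[/andP[? ?] /andP[? ?]]; exfalso; lra.
  + by move=> h; rewrite (tI' k l)//; exists r.
- move=> i; rewrite -(splitK i); case: (fintype.split i) => j /=.
    by rewrite !catl.
  by rewrite !catr.
- rewrite big_split_ord /=.
  under eq_bigr do rewrite !catl.
  under [in X in _ + (_ + X)]eq_bigr do rewrite !catr.
  have -> : f z - f x = (f z - f y) + (f y - f x) by rewrite addrA subrK.
  apply: (le_trans (ler_normD _ _)); lra.
Qed.

(** If [x] is in [U], the family is the single interval from [y] to [z]. Otherwise the family is
    empty and the slope bound at [x] suffices: as [y <= x <= z], the distances from [x] add up to
    exactly [z - y]. *)
Lemma increment_covered_local (R : realType) (V : normedModType R)
    (f : R -> V) (e : R) (U : set R) (x : R) : 0 < e -> open U ->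
  (U x \/ derivable f x 1 /\ derive1 f x = 0) ->
  exists2 d : R, 0 < d & forall y z, x - d < y <= x -> x <= z < x + d ->
    increment_covered f e U y z.
Proof.
move=> e0 oU [Ux|[df f'0]].
  have /nbhs_ballP[d d0 dU] : nbhs x U by exact: open_nbhs_nbhs.
  exists d => // y z /andP[xy yx] /andP[xz zx].
  exists 1%N, (fun=> y), (fun=> z); split.
  - by move=> _; split=> //; lra.
  - by move=> i j _ _ _; rewrite !ord1.
  - move=> _ w /=; rewrite in_itv /= => /andP[yw wz]; apply: dU.
    by rewrite /ball /= ltr_norml; lra.
  - by rewrite big_ord1 lerDr mulr_ge0//; lra.
have : \forall h \near 0^', `|h^-1 *: (f (h + x) - f x)| <= e.
  have /cvgrPdist_le/(_ e e0) : h^-1 *: (f (h + x) - f x) @[h --> 0^'] --> (0 : V).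
    rewrite -f'0 derive1E.
    have -> : (fun h : R => h^-1 *: (f (h + x) - f x)) =
       (fun h : R => h^-1 *: ((f \o shift x) (h *: (1 : R)) - f x)).
      by apply/funext => h /=; rewrite /GRing.scale/= mulr1.
    exact: df.
  by apply: filterS => h; rewrite sub0r normrN.
rewrite near_withinE => /nbhs_norm0P[d /= d0 dP].
have fx w : `|w - x| < d -> `|f w - f x| <= e * `|w - x|.
  move=> wd; have [->|wx] := eqVneq w x; first by rewrite !subrr !normr0 mulr0.
  have wx0 : w - x != 0 by rewrite subr_eq0.
  have := dP (w - x) wd wx0; rewrite subrK normrZ normfV.
  by rewrite ler_pdivrMl ?normr_gt0// mulrC.
exists d => // y z /andP[xy yx] /andP[xz zx].
have tI : trivIset [set: 'I_0] (fun i => `]0, 0[%classic : set R) by case.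
exists 0%N, (fun=> 0), (fun=> 0); split=> //; try by case.
rewrite big_ord0 addr0.
have -> : f z - f y = (f z - f x) - (f y - f x) by rewrite opprB addrA subrK.
apply: (le_trans (ler_normB _ _)).
have zxE : `|z - x| = z - x by rewrite ger0_norm//; lra.
have yxE : `|y - x| = x - y by rewrite ler0_norm ?opprB//; lra.
have := fx z; have := fx y; rewrite zxE yxE => fy fz.
have {}fy : `|f y - f x| <= e * (x - y) by apply: fy; lra.
have {}fz : `|f z - f x| <= e * (z - x) by apply: fz; lra.
lra.
Qed.

Lemma derive_eq0_abs_continuous_constant (R : realType) (V : normedModType R)
    (f : R -> V) (a b : R) : a <= b -> abs_continuous_on a b f ->
  {ae lebesgue_measure, forall t : R, a <= t <= b ->
     derivable f t 1 /\ derive1 f t = 0} ->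
  f b = f a.
Proof.
move=> ab fac [N [mN N0 subN]].
(* The term [e * (b - a)] comes from the points with zero derivative, the extra [e] from the
   intervals in [U]. *)
suff bnd e : 0 < e -> `|f b - f a| <= e * (b - a + 1).
  apply/eqP; rewrite -subr_eq0 -normr_le0; apply/ler_addgt0Pl => e e0.
  have ba : 0 < b - a + 1 by lra.
  have := bnd (e / (b - a + 1)) (divr_gt0 e0 ba).
  by rewrite addr0 divfK// gt_eqF.
move=> e0; have [d d0 dP] := fac e e0.
have [|U [oU NU UN]] := lebesgue_regularity_outer mN _ d0.
  by rewrite [ltLHS]N0 ltry.
have mU : measurable U by exact: open_measurable.
(* Outer regularity bounds the measure of [U] minus [N]; since [N] is null, the bound passes to
   [U]. *)
have Ud : (lebesgue_measure U < d%:E)%E.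
  have := measureDI lebesgue_measure mU mN.
  by rewrite (setIidr NU) [X in (_ + X)%E]N0 adde0 => UE; rewrite [ltLHS]UE.
have [m [s [t [st tI sU fab]]]] : increment_covered f e U a b.
  apply: cousin_segment => //; first exact: increment_covered_add.
  move=> x xab.
  have [|d' d'0 d'P] := increment_covered_local (f := f) (x := x) e0 oU.
    have [Nx|Nx] := pselect (N x); first by left; exact: NU.
    by right; apply: contrapT => h; apply: Nx; apply: subN => /= /(_ xab).
  by exists d' => // y z _ + + _; exact: d'P.
have sd : \sum_(i < m) (t i - s i) < d.
  rewrite -lte_fin; apply: le_lt_trans Ud.
  by apply: sum_itv_le_measure => // i; have [] := st i.
by have := dP m s t st tI sd; lra.
Qed.

(** * Left continuity, translation in time, derivatives as limits *)

Lemma abs_continuous_on_left_continuous (R : realType) (V : normedModType R)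
    (f : R -> V) (a b e : R) : abs_continuous_on a b f -> 0 < e ->
  exists2 d : R, 0 < d &
    forall s, a <= s <= b -> b - s < d -> `|f b - f s| < e.
Proof.
move=> fac e0; have [d d0 dP] := fac e e0; exists d => // s /andP[as_ sb] bsd.
have := dP 1%N (fun=> s) (fun=> b); rewrite !big_ord1; apply => //.
by move=> i j _ _ _; rewrite !ord1.
Qed.

Lemma loc_abs_continuous_comp_shift (R : realType) (V : normedModType R)
    (D : set R) (f : R -> V) (s : R) : loc_abs_continuous D f ->
  loc_abs_continuous [set t | 0 <= t /\ D (t + s)] (fun t => f (t + s)).
Proof.
move=> fac a b abD e e0.
have [|d d0 dP] := fac (a + s) (b + s) _ e e0.
  move=> x /=; rewrite in_itv /= => /andP[ax xb].
  have [|_] := abD (x - s); last by rewrite subrK.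
  by rewrite /= in_itv /=; lra.
exists d => // m u v uv tI uvd.
apply: (dP m (fun i => u i + s) (fun i => v i + s)).
- by move=> i; have [? ? ?] := uv i; split; lra.
- move=> i j _ _ [x [/=]]; rewrite !in_itv /= => /andP[? ?] /andP[? ?].
  apply: (tI i j) => //; exists (x - s); split; rewrite /= in_itv /=; lra.
- by under eq_bigr do rewrite opprD addrACA subrr addr0.
Qed.

(** The pushforward of Lebesgue measure by a translation gives half-open intervals their length, so
    uniqueness applies. *)
Lemma lebesgue_measure_shift (R : realType) (A : set R) (s : R) :
  measurable A -> lebesgue_measure [set t | A (t + s)] = lebesgue_measure A.
Proof.
move=> mA.
have ms : measurable_fun [set: measurableTypeR R]
   (fun t : measurableTypeR R => (t + s : measurableTypeR R)).
  exact: measurable_funD.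
pose f : {mfun measurableTypeR R >-> measurableTypeR R} :=
  @mfun_Sub _ _ (measurableTypeR R) (measurableTypeR R) (fun t => t + s)
    (mem_set ms).
change (pushforward lebesgue_measure f A = lebesgue_measure A).
apply/esym/lebesgue_measure_unique => //=.
move=> _ [[a b]] _ <-; rewrite /pushforward.
rewrite (_ : _ @^-1` _ = `]a - s, b - s]%classic); last first.
  by apply/seteqP; split => t /=; rewrite !in_itv /=; lra.
rewrite !lebesgue_measure_itv /= !lte_fin ltrD2r; case: ifP => // _.
by rewrite -!EFinD; congr EFin; ring.
Qed.

Lemma ae_sub (R : realType) (P Q : R -> Prop) : (forall t, P t -> Q t) ->
  {ae lebesgue_measure, forall t : R, P t} ->
  {ae lebesgue_measure, forall t : R, Q t}.
Proof.
move=> PQ [N [mN N0 subN]]; exists N; split => //.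
by apply: subset_trans subN; apply: subsetC => t; exact: PQ.
Qed.

Lemma ae_shift (R : realType) (P : R -> Prop) (s : R) :
  {ae lebesgue_measure, forall t : R, P t} ->
  {ae lebesgue_measure, forall t : R, P (t + s)}.
Proof.
move=> [N [mN N0 subN]]; exists [set t | N (t + s)]; split.
- rewrite -[X in measurable X]setTI.
  by have : measurable_fun [set: measurableTypeR R]
     (fun t : measurableTypeR R => (t + s : measurableTypeR R));
    [exact: measurable_funD | apply].
- by rewrite lebesgue_measure_shift.
- by move=> t /=; exact: subN.
Qed.

Lemma derive1_quotE (R : realType) (V : normedModType R) (f : R -> V) (x : R) :
  (fun h : R => h^-1 *: ((f \o shift x) (h *: (1 : R)) - f x)) =
  (fun h => h^-1 *: (f (h + x) - f x)).
Proof. by apply/funext => h /=; rewrite /GRing.scale/= mulr1. Qed.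

(** Existence and value of the derivative become one limit statement, so that translations and pairs
    reduce to facts about limits. *)
Lemma derivable_derive1P (R : realType) (V : normedModType R) (f : R -> V)
    (x : R) (l : V) :
  (derivable f x 1 /\ derive1 f x = l) <->
  h^-1 *: (f (h + x) - f x) @[h --> 0^'] --> l.
Proof.
rewrite /derivable derive1_quotE; split => [[df <-] //|df].
by split; [apply/cvg_ex; exists l | exact: cvg_lim].
Qed.

Lemma derive1_comp_shift (R : realType) (V : normedModType R) (f : R -> V)
    (s t : R) (l : V) :
  derivable f (t + s) 1 /\ derive1 f (t + s) = l ->
  derivable (fun u => f (u + s)) t 1 /\ derive1 (fun u => f (u + s)) t = l.
Proof.
move=> /derivable_derive1P df; apply/derivable_derive1P.
by under eq_fun do rewrite -addrA.
Qed.

Lemma derive1_pair (R : realType) (V W : normedModType R) (f : R -> V)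
    (g : R -> W) (x : R) (l : V) (l' : W) :
  (derivable (fun t => (f t, g t)) x 1 /\
   derive1 (fun t => (f t, g t)) x = (l, l')) <->
  (derivable f x 1 /\ derive1 f x = l) /\ (derivable g x 1 /\ derive1 g x = l').
Proof.
rewrite !derivable_derive1P; split; last first.
  by move=> [df dg]; exact: cvg_pair df dg.
move=> dfg; split; first exact: cvg_comp dfg cvg_fst.
exact: cvg_comp dfg cvg_snd.
Qed.

(** * Operations on solutions *)

(** Membership in [C] is only given on the interior of [D], and [t] may be its right endpoint. Any
    [t > 0] in [D] is a left limit of interior points, and [phi] is left continuous there. *)
Lemma solution_in_closure (R : realType) (V : normedModType R)
    (C : set V) (F : V -> set V) (D : set R) (phi : R -> V) (t : R) :
  is_solution C F D phi -> D t -> closure C (phi t).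
Proof.
move=> [[iD D0 Dge0] [fac C0 Cint _]] Dt.
have [->//|tn0] := eqVneq t 0.
have t0 : 0 < t by rewrite lt_neqAle eq_sym tn0; exact: Dge0.
have sub : `[0, t]%classic `<=` D.
  by move=> s /=; rewrite in_itv /= => st; exact: (iD 0 t).
move=> A /nbhs_ballP[e e0 eA].
have [d d0 dP] := abs_continuous_on_left_continuous (fac _ _ sub) e0.
(* The first bound keeps [s] positive, the second keeps it within [d] of [t]. *)
pose s := Num.max (t / 2) (t - d / 2).
have ts : t / 2 <= s by rewrite /s le_max lexx.
have ds : t - d / 2 <= s by rewrite /s le_max lexx orbT.
have st : s < t by rewrite /s gt_max; apply/andP; split; lra.
exists (phi s); split; last first.
  by apply: eA; rewrite -ball_normE /=; apply: dP; lra.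
apply: Cint; rewrite /interior.
have : \forall x \near s, x \in `]0, t[.
  by apply: near_in_itvoo; rewrite in_itv /=; lra.
apply: filterS => x; rewrite in_itv /= => /andP[x0 xt].
by apply: sub; rewrite /= in_itv /= !ltW.
Qed.

Lemma solution_comp_shift (R : realType) (V : normedModType R)
    (C : set V) (F : V -> set V) (D : set R) (phi : R -> V) (s : R) :
  is_solution C F D phi -> D s ->
  is_solution C F [set t | 0 <= t /\ D (t + s)] (fun t => phi (t + s)).
Proof.
move=> sol Ds; have [[iD D0 Dge0] [fac C0 Cint dphi]] := sol.
split; split.
- move=> x y [x0 Dx] [y0 Dy] z /andP[xz zy]; split; first lra.
  by apply: (iD _ _ Dx Dy); rewrite !lerD2r xz.
- by rewrite /= add0r.
- by move=> t [].
- exact: loc_abs_continuous_comp_shift.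
(* The new initial point may come from an endpoint of [D], so only membership in the closure is
   available. *)
- by rewrite add0r; exact: solution_in_closure sol Ds.
- move=> t /nbhs_ballP[d d0 dD]; apply: Cint; apply/nbhs_ballP.
  exists d => // x.
  rewrite -ball_normE /= => tx; have [|_] := dD (x - s); last by rewrite subrK.
  by rewrite -ball_normE /= opprB addrA.
- apply: ae_sub (ae_shift s dphi) => t /[swap] -[_ Dts] /(_ Dts)[df Ff].
  by have [dg ->] := derive1_comp_shift (conj df erefl).
Qed.

Lemma solution_augmented (R : realType) (n : nat)
    (C : set 'rV[R]_n) (F : 'rV[R]_n -> set 'rV[R]_n) (D : set R)
    (phi : R -> 'rV[R]_n) (c : R) :
  is_solution C F D phi ->
  is_solution (C `*` [set: R]) (augmented_map F) D (fun t => (phi t, c)).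
Proof.
move=> [[iD D0 Dge0] [fac C0 Cint dphi]]; split; split => //.
- move=> a b abD e e0; have [d d0 dP] := fac a b abD e e0.
  exists d => // m s t st tI sd.
  (* In the max norm, the constant component adds nothing to an increment. *)
  under eq_bigr => i _.
    have -> : (phi (t i), c) - (phi (s i), c) =
      (phi (t i) - phi (s i), c - c) by [].
    rewrite prod_normE /= subrr normr0 max_l//.
    over.
  exact: dP.
- move=> A /nbhs_ballP[e e0 eA].
  have [|x [Cx px]] := C0 (ball (phi 0) e); first exact: nbhsx_ballx.
  by exists (x, c); split => //; apply: eA; split => //=; exact: ballxx.
- by move=> t /Cint.
- apply: ae_sub dphi => t /[apply] -[df Ff].
  have dc : derivable (fun=> c) t 1 /\ derive1 (fun=> c) t = 0.
    by split; [exact: derivable_cst | rewrite derive1_cst].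
  by have [dg ->] := (derive1_pair _ _ _ _ _).2 (conj (conj df erefl) dc).
Qed.

Lemma solution_augmented_fst (R : realType) (n : nat)
    (C : set 'rV[R]_n) (F : 'rV[R]_n -> set 'rV[R]_n) (D : set R)
    (psi : R -> 'rV[R]_n * R) :
  is_solution (C `*` [set: R]) (augmented_map F) D psi ->
  is_solution C F D (fst \o psi).
Proof.
move=> [[iD D0 Dge0] [fac C0 Cint dpsi]]; split; split => //.
- move=> a b abD e e0; have [d d0 dP] := fac a b abD e e0.
  exists d => // m s t st tI sd.
  apply: le_lt_trans (dP m s t st tI sd); apply: ler_sum => i _.
  by rewrite prod_normE le_max lexx.
- move=> A /nbhs_ballP[e e0 eA].
  have [|x [[Cx _] [px _]]] := C0 (ball (psi 0) e); first exact: nbhsx_ballx.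
  by exists x.1; split => //; apply: eA.
- by move=> t /Cint[].
- apply: ae_sub dpsi => t /[apply] -[df [Ff _]].
  (* Writing [psi] as an explicit pair of functions lets [derive1_pair] split its derivative. *)
  have psiE : psi = (fun u => ((fst \o psi) u, (snd \o psi) u)).
    by apply/funext => u /=; case: (psi u).
  move: df Ff; rewrite psiE => df.
  have [[d1 e1] _] := (derive1_pair _ _ _ _ _).1
     (conj df (surjective_pairing _)).
  by rewrite -e1.
Qed.

Lemma solution_augmented_snd (R : realType) (n : nat)
    (C : set 'rV[R]_n) (F : 'rV[R]_n -> set 'rV[R]_n) (D : set R)
    (psi : R -> 'rV[R]_n * R) (t : R) :
  is_solution (C `*` [set: R]) (augmented_map F) D psi -> D t ->
  (psi t).2 = (psi 0).2.
Proof.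
move=> [[iD D0 Dge0] [fac C0 Cint dpsi]] Dt.
have sub : `[0, t]%classic `<=` D.
  by move=> s /=; rewrite in_itv /= => st; exact: (iD 0 t).
(* Increments of the last component are bounded by those of [psi] in the max norm, so absolute
   continuity is inherited. *)
apply: (@derive_eq0_abs_continuous_constant _ R^o (snd \o psi) 0 t).
- exact: Dge0.
- move=> e e0; have [d d0 dP] := fac _ _ sub e e0.
  exists d => // m s u su sI sd.
  apply: le_lt_trans (dP m s u su sI sd); apply: ler_sum => i _.
  by rewrite prod_normE le_max lexx orbT.
- apply: ae_sub dpsi => s dpsi s0t.
  have [|df [_ Ff]] := dpsi; first by apply: sub; rewrite /= in_itv.
  have psiE : psi = (fun u => ((fst \o psi) u, (snd \o psi) u)).
    by apply/funext => u /=; case: (psi u).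
  move: df Ff; rewrite psiE => df.
  have [_ [d2 e2]] := (derive1_pair _ _ _ _ _).1
     (conj df (surjective_pairing _)).
  by rewrite -e2.
Qed.

Unset Implicit Arguments.
Set Strict Implicit.

Theorem lemma2 (R : realType) (n : nat)
    (C : set 'rV[R]_n) (F : 'rV[R]_n -> set 'rV[R]_n) (B : 'rV[R]_n -> R)
    (Fusc : upper_semicontinuous_map F)
    (Fcompact : forall x : 'rV[R]_n, compact (F x))
    (Fconvex : forall x : 'rV[R]_n, convex_set (F x))
    (Blsc : lower_semicontinuous (EFin \o B)) :
  (forall (D : set R) (phi : R -> 'rV[R]_n),
     is_solution C F D phi -> {in D &, nonincreasing_fun (B \o phi)})
  <->
  forward_pre_invariant (C `*` [set: R]) (augmented_map F)
    (epi B `&` (closure C `*` [set: R])).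
Proof.
split => [Bnincr D psi sol [epi0 _] t Dt | inv D phi sol s t sD tD st].
  have sol1 := solution_augmented_fst sol.
  have [[_ D0 Dge0] _] := sol.
  split; last by split => //; exact: solution_in_closure sol1 Dt.
  rewrite /epi /= (solution_augmented_snd sol Dt).
  apply: le_trans epi0.
  exact: (Bnincr _ _ sol1 0 t (mem_set D0) (mem_set Dt) (Dge0 _ Dt)).
have Ds := set_mem sD.
have sols := solution_augmented (B (phi s)) (solution_comp_shift sol Ds).
(* Time [t - s] of the shifted solution is time [t] of [phi]; being in the epigraph there means
   [B (phi t) <= B (phi s)]. *)
have [||+ _] := inv _ _ sols _ (t - s).
- rewrite add0r; split; first exact: lexx.
  by split => //; exact: solution_in_closure sol Ds.
- by rewrite /= subr_ge0 subrK; split => //; exact: set_mem.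
- by rewrite /epi /= subrK.
Qed.
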